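(* Let $\mathcal{P}$ be a PTRS with only finitely many rules, and suppose the signature $\Sigma$ over which terms are built contains a function symbol of arity at least $2$. Then $\mathtt{PAST}(\xrightarrow{\mathbf{f}}_{\mathcal{P}})$ holds if and only if $\mathtt{SAST}(\xrightarrow{\mathbf{f}}_{\mathcal{P}})$ holds.
   Context: Terms $\mathcal{T}$ over the signature $\Sigma$ and countable variables. $\mathrm{FDist}(A)$: finite multisets of pairs $(p:a)$, $0<p\le1$, probabilities summing to 1. A PTRS is a countable set $\mathcal{P}$ of rules $\ell\to\mu$, $\ell$ non-variable, $\mu\in\mathrm{FDist}(\mathcal{T})$, variables of terms in $\mu$ among those of $\ell$. $t\xrightarrow{\mathbf{f}}_{\mathcal{P}}\{p_1:t_1,\dots,p_k:t_k\}$ iff $t|_\pi=\ell\sigma$, $t_j=t[r_j\sigma]_\pi$ for a position $\pi$, rule $\ell\to\{p_1:r_1,\dots,p_k:r_k\}$, substitution $\sigma$; normal forms admit no step. Lifting $\rightrightarrows$: smallest relation on multi-distributions with $\{1:t\}\rightrightarrows\{1:t\}$ for normal forms, $\{1:t\}\rightrightarrows\mu$ if $t\xrightarrow{\mathbf{f}}_{\mathcal{P}}\mu$, closed under $\bigcup_jp_j\cdot\mu_j\rightrightarrows\bigcup_jp_j\cdot\nu_j$ ($\sum p_j=1$). $|\mu|$: probability of normal forms; $\mathrm{edl}((\mu_n))=\sum_n(1-|\mu_n|)$. $\mathtt{PAST}$: every infinite $\rightrightarrows$-sequence with $\mu_0=\{1:t\}$ has finite $\mathrm{edl}$. $\mathtt{SAST}$: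 for every term $t$ the supremum of $\mathrm{edl}$ over all infinite $\rightrightarrows$-sequences with $\mu_0=\{1:t\}$ is finite. *)

(* Defs.v *)
From HB Require Import structures.
From mathcomp Require Import all_boot all_order all_algebra.
From mathcomp Require Import finmap multiset.
From mathcomp Require Import all_classical all_reals all_analysis.
Set Implicit Arguments.
Unset Strict Implicit.
Unset Printing Implicit Defensive.
Import Order.TTheory GRing.Theory Num.Theory.
Local Open Scope classical_set_scope.
Local Open Scope ring_scope.

Notation multidist R A := {mset (R * A)%type}%mset.

Section MultiDistributions.
Variable R : realType.

Definition is_fdist (A : choiceType) (mu : multidist R A) : Prop :=
  (forall x : (R * A)%type, x \in mu -> 0 < x.1 <= 1)
  /\ \sum_(x <- mu) x.1 = 1.

Definition mset_map (A B : choiceType) (f : A -> B) (mu : {mset A}%mset) :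
  {mset B}%mset := seq_mset [seq f x | x <- mu].

Definition mdist_scale (A : choiceType) (p : R) (mu : multidist R A) :
    multidist R A :=
  mset_map (fun x : (R * A)%type => (p * x.1, x.2)) mu.

Definition mdirac (A : choiceType) (a : A) : multidist R A :=
  [mset (1, a)]%mset.

End MultiDistributions.

Section ProbabilisticARS.
Variables (R : realType) (A : choiceType).
Variable red : A -> multidist R A -> Prop.

Definition normal_form (a : A) : Prop := ~ exists mu, red a mu.

(* Although stated on arbitrary multisets, this only relates multi-distributions
   when red does; see mlift_fdist and rewrite_full_fdist. *)
Inductive mlift :
    multidist R A -> multidist R A -> Prop :=
| mlift_nf a : normal_form a -> mlift (mdirac R a) (mdirac R a)
| mlift_red a mu : red a mu -> mlift (mdirac R a) mu
| mlift_union k (p : 'I_k -> R) (mu nu : 'I_k -> multidist R A) :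
    (forall j, 0 < p j <= 1) -> \sum_(j < k) p j = 1 ->
    (forall j, mlift (mu j) (nu j)) ->
    mlift (\big[@msetD _/mset0]_(j < k) mdist_scale (p j) (mu j))
         (\big[@msetD _/mset0]_(j < k) mdist_scale (p j) (nu j)).

Definition nf_mass (mu : multidist R A) : R :=
  \sum_(x <- mu | `[< normal_form x.2 >]) x.1.

Definition mlift_seq_from (a : A) : set (nat -> multidist R A) :=
  [set mu | mu 0%N = mdirac R a /\ forall n, mlift (mu n) (mu n.+1)].

Definition edl (mu : nat -> multidist R A) : \bar R :=
  (\sum_(0 <= n <oo) (1 - nf_mass (mu n))%:E)%E.

Definition PAST : Prop :=
  forall a mu, mlift_seq_from a mu -> (edl mu < +oo)%E.

Definition SAST : Prop :=
  forall a, (ereal_sup [set edl mu | mu in mlift_seq_from a] < +oo)%E.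

End ProbabilisticARS.

Record signature := Signature {
  symbol : Type;
  arity : symbol -> nat }.

Inductive term (S : signature) (V : countType) : Type :=
| Var of V
| App (f : symbol S) of ('I_(arity f) -> term S V).

Arguments Var {S V} _.
Arguments App {S V} f _.

HB.instance Definition _ (S : signature) (V : countType) :=
  gen_eqMixin (term S V).
HB.instance Definition _ (S : signature) (V : countType) :=
  gen_choiceMixin (term S V).

Section Terms.
Variables (S : signature) (V : countType).

Definition is_var (t : term S V) : bool := if t is Var _ then true else false.

Fixpoint vars (t : term S V) : set V :=
  match t with
  | Var x => [set x]
  | App f a => \bigcup_(i in [set: 'I_(arity f)]) vars (a i)
  end.

Fixpoint subst (s : V -> term S V) (t : term S V) : term S V :=
  match t with
  | Var x => s x
  | App f a => App f (fun i => subst s (a i))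
  end.

(* Positions are words over argument indices, counted from 0; None signals a
   position outside of t. *)
Fixpoint subterm_at (t : term S V) (pi : seq nat) : option (term S V) :=
  match pi, t with
  | [::], _ => Some t
  | i :: pi', App f a =>
      if (insub i : option 'I_(arity f)) is Some j
      then subterm_at (a j) pi' else None
  | _ :: _, Var _ => None
  end.

(* Leaves t unchanged if pi is not a position of t. *)
Fixpoint replace_at (t : term S V) (pi : seq nat) (u : term S V) : term S V :=
  match pi, t with
  | [::], _ => u
  | i :: pi', App f a =>
      App f (fun j : 'I_(arity f) =>
        if val j == i then replace_at (a j) pi' u else a j)
  | _ :: _, Var _ => t
  end.

End Terms.

Section PTRS.
Variables (R : realType) (S : signature) (V : countType).

Definition rule := (term S V * multidist R (term S V))%type.

Definition is_rule (r : rule) : Prop :=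
  [/\ ~~ is_var r.1,
      is_fdist r.2
    & forall x : (R * term S V)%type, x \in r.2 -> vars x.2 `<=` vars r.1].

Record ptrs := Ptrs {
  rules :> set rule;
  rules_countable : countable rules;
  rules_wf : forall r, rules r -> is_rule r }.

Definition rewrite_full (P : ptrs)
    (t : term S V) (nu : multidist R (term S V)) : Prop :=
  exists (r : rule) (pi : seq nat) (s : V -> term S V),
    [/\ rules P r,
        subterm_at t pi = Some (subst s r.1)
      & nu = mset_map (fun x : (R * term S V)%type =>
                         (x.1, replace_at t pi (subst s x.2))) r.2].

End PTRS.

Lemma enum_msetD_perm (K : choiceType) (B C : {mset K}%mset) :
  perm_eq (B `+` C)%mset (enum_mset B ++ C).
Proof.
apply/allP => x _ /=; rewrite count_cat.
by rewrite !count_mem_mset msetE2.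
Qed.

Lemma is_fdist_union (R : realType) (A : choiceType) k (p : 'I_k -> R)
    (mu : 'I_k -> multidist R A) :
  (forall j, 0 < p j <= 1) -> \sum_(j < k) p j = 1 ->
  (forall j, is_fdist (mu j)) ->
  is_fdist (\big[@msetD _/mset0]_(j < k) mdist_scale (p j) (mu j)).
Proof.
move=> p01 p1 mufd.
have memS j x : x \in mdist_scale (p j) (mu j) -> 0 < x.1 <= 1.
  rewrite /mdist_scale /mset_map (perm_mem (perm_eq_seq_mset _)).
  case/mapP=> y ymu -> /=; have /andP[y0 y1] := (mufd j).1 y ymu.
  have /andP[p0 p1'] := p01 j.
  by rewrite mulr_gt0 //= mulr_ile1 // ltW.
split.
  move=> x; elim/big_ind : _ => [|B C IHB IHC|j _].
  - by rewrite in_mset0.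
  - by rewrite in_msetD => /orP[/IHB|/IHC].
  - exact: memS.
rewrite -[RHS]p1.
apply: (big_ind2 (fun (B : multidist R A) (b : R) => \sum_(x <- B) x.1 = b)) => [|B b C c <- <-|j _].
- by rewrite enum_mset0 big_nil.
- by rewrite (perm_big _ (enum_msetD_perm _ _)) /= big_cat.
- rewrite /mdist_scale /mset_map (perm_big _ (perm_eq_seq_mset _)) /= big_map /=.
  by rewrite -mulr_sumr (mufd j).2 mulr1.
Qed.

Lemma mlift_fdist (R : realType) (A : choiceType)
    (red : A -> multidist R A -> Prop) mu nu :
  (forall a mu, red a mu -> is_fdist mu) ->
  mlift red mu nu -> is_fdist mu /\ is_fdist nu.
Proof.
move=> redP; have dfd (a : A) : is_fdist (mdirac R a).
  split; first by move=> x; rewrite in_msetn /= => /eqP -> /=; rewrite ltr01 lexx.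
  by rewrite enum_msetn /= big_seq1.
elim=> [a _|a mu' /redP|k p mu' nu' p01 p1 _ IH] //.
by split; apply: is_fdist_union => // j; case: (IH j).
Qed.

Lemma rewrite_full_fdist (R : realType) S V (P : ptrs R S V) t nu :
  rewrite_full P t nu -> is_fdist nu.
Proof.
case=> r [pi [s [/rules_wf[_ [r01 r1] _] _ ->]]]; rewrite /mset_map; split.
  move=> x; rewrite (perm_mem (perm_eq_seq_mset _)) => /mapP[y /r01 + ->] //.
by rewrite (perm_big _ (perm_eq_seq_mset _)) /= big_map.
Qed.

(* Main.v *)
Require Import Defs.
From HB Require Import structures.
From mathcomp Require Import all_boot all_order all_algebra.
From mathcomp Require Import finmap multiset.
From mathcomp Require Import all_classical all_reals all_analysis.
From mathcomp Require Import ring lra.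
Set Implicit Arguments.
Unset Strict Implicit.
Unset Printing Implicit Defensive.
Import Order.TTheory GRing.Theory Num.Theory.
Local Open Scope classical_set_scope.
Local Open Scope ring_scope.

(** Only PAST => SAST needs an argument. Reduction is finitely branching, so for
each k the maximal expected number of steps within k rounds is attained by a
greedy strategy. If SAST fails, these maxima are unbounded for some term t, and
finite branching propagates this along an infinite path t = t_0, t_1, ..., where
t_(n+1) is reached from t_n with probability p_n. Start from f(t, t, ...) with f
at least binary and follow the path in the first argument, switching to greedy
play in the untouched second argument t as soon as the path is left; the horizon
of the greedy play is chosen such that leaving at step n is worth at least
1 / (w_n w_(n+1)) expected steps, where w_n = p_0 ... p_(n-1). By PAST the
expected number of steps T_n from the n-th point of the path is finite, and
  T_n >= 1 + p_n T_(n+1) + (1 - p_n) / (w_n w_(n+1)).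
Unfolding this n times gives T_0 >= n w_n + 1 / w_n - 1, and n = k^2 yields
T_0 >= 2 k - 1 for every k by AM-GM, which is absurd. *)

Lemma finite_set_argmax d (T : orderType d) (I : choiceType) (F : I -> T)
    (D : set I) :
  finite_set D -> D !=set0 ->
  exists2 i, D i & forall j, D j -> (F j <= F i)%O.
Proof.
move=> /finite_fsetP[A ->] [i0 Ai0].
have [i _ imax] := @Order.TotalTheory.arg_maxP _ _ _ [` Ai0]%fset predT
  (F \o val) isT.
by exists (val i) => [|j Aj]; [exact: valP|exact: (imax [` Aj]%fset)].
Qed.

Lemma finite_subset1 (T : Type) (D : set T) : is_subset1 D -> finite_set D.
Proof.
move=> D1; have [->|/set0P[x Dx]] := eqVneq D set0; first exact: finite_set0.
by apply: (sub_finite_set _ (finite_set1 x)) => y Dy; exact: D1.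
Qed.

Section EscapeRecursion.
Variables (R : realFieldType) (p : nat -> R).
Hypothesis p01 : forall n, 0 < p n <= 1.

Definition survival (n : nat) : R := \prod_(i < n) p i.

Lemma survivalS n : survival n.+1 = survival n * p n.
Proof. by rewrite /survival big_ord_recr. Qed.

Lemma survival_gt0 n : 0 < survival n.
Proof. by apply: prodr_gt0 => i _; case/andP: (p01 i). Qed.

Lemma survivalS_le n : survival n.+1 <= survival n.
Proof.
have /andP[_ p1] := p01 n.
by rewrite survivalS ler_piMr // ltW // survival_gt0.
Qed.

(* The lower bound on [h] makes the gain [(w n - w n.+1) * h n] at least
   [(w n.+1)^-1 - (w n)^-1], where [w := survival], and these telescope. *)
Lemma escape_recursion_ge (h T : nat -> R) :
  (forall n, (survival n * survival n.+1)^-1 <= h n) ->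
  (forall n, 1 + (p n * T n.+1 + (1 - p n) * h n) <= T n) ->
  forall n, n%:R * survival n + (survival n)^-1 - 1 + survival n * T n <= T 0.
Proof.
move=> h_large Trec; elim=> [|n IH].
  by rewrite /survival big_ord0 invr1 mul0r !mul1r add0r subrr add0r.
apply: le_trans IH.
have w0 := survival_gt0 n; have w'0 := survival_gt0 n.+1.
have gain : (survival n.+1)^-1 - (survival n)^-1 <=
    (survival n - survival n.+1) * h n.
  have -> : (survival n.+1)^-1 - (survival n)^-1 =
      (survival n - survival n.+1) * (survival n * survival n.+1)^-1.
    by field; rewrite !gt_eqF.
  by rewrite ler_wpM2l ?h_large // subr_ge0 survivalS_le.
have := ler_wpM2l (ltW w0) (Trec n).
have := ler_wpM2l (ler0n R n.+1) (survivalS_le n).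
move: gain; rewrite survivalS -natr1; lra.
Qed.

End EscapeRecursion.

Lemma escape_recursion_no_solution (R : archiRealFieldType) (p h : nat -> R) :
  (forall n, 0 < p n <= 1) ->
  (forall n, (survival p n * survival p n.+1)^-1 <= h n) ->
  ~ exists2 T : nat -> R, forall n, 0 <= T n &
      forall n, 1 + (p n * T n.+1 + (1 - p n) * h n) <= T n.
Proof.
move=> p01 h_large [T T0 /(escape_recursion_ge p01 h_large) Tge].
pose k := (Num.bound (T 0)).+1.
have Tk : T 0 < k%:R.
  by apply: lt_le_trans (archi_boundP (T0 0%N)) _; rewrite ler_nat.
have k1 : 1 <= k%:R :> R by rewrite ler1n.
have := Tge (k ^ 2)%N; set w := survival p _; rewrite natrX.
have w0 : 0 < w by exact: survival_gt0.
have amgm : 2 * k%:R <= k%:R ^+ 2 * w + w^-1.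
  rewrite -subr_ge0.
  have -> : k%:R ^+ 2 * w + w^-1 - 2 * k%:R = (k%:R * w - 1) ^+ 2 / w.
    by field; rewrite gt_eqF.
  by rewrite divr_ge0 ?sqr_ge0 // ltW.
have := mulr_ge0 (ltW w0) (T0 (k ^ 2)%N).
lra.
Qed.

Section Expectation.
Variable R : realType.

Definition expect (Q : Type) (g : Q -> R) (s : seq (R * Q)) : R :=
  \sum_(x <- s) x.1 * g x.2.

Definition push (Q : Type) (A : choiceType) (f : Q -> A) (s : seq (R * Q)) :
  multidist R A := seq_mset [seq (x.1, f x.2) | x <- s].

Lemma fdist_weight_ge0 (A : choiceType) (mu : multidist R A) :
  is_fdist mu -> forall x, x \in mu -> 0 <= x.1.
Proof. by move=> [mu01 _] x /mu01 /andP[/ltW]. Qed.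

Lemma le_expect (Q : eqType) (g g' : Q -> R) (s : seq (R * Q)) :
  (forall x, x \in s -> 0 <= x.1) -> (forall x, x \in s -> g x.2 <= g' x.2) ->
  expect g s <= expect g' s.
Proof.
move=> s0 gg'; rewrite /expect !big_seq; apply: ler_sum => x xs.
by rewrite ler_wpM2l ?s0 ?gg'.
Qed.

Lemma expect_ge0 (Q : eqType) (g : Q -> R) (s : seq (R * Q)) :
  (forall x, x \in s -> 0 <= x.1) -> (forall q, 0 <= g q) -> 0 <= expect g s.
Proof.
move=> s0 g0; rewrite /expect big_seq; apply: sumr_ge0 => x xs.
by rewrite mulr_ge0 ?s0.
Qed.

Lemma expect1 (Q : Type) (g : Q -> R) q : expect g [:: (1, q)] = g q.
Proof. by rewrite /expect big_seq1 mul1r. Qed.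

Lemma expect_map (Q Q' : Type) (f : Q -> Q') (g : Q' -> R) (s : seq (R * Q)) :
  expect g [seq (x.1, f x.2) | x <- s] = expect (g \o f) s.
Proof. by rewrite /expect big_map. Qed.

Lemma expect_push (Q : Type) (A : choiceType) (f : Q -> A) (g : A -> R) s :
  expect g (push f s) = expect (g \o f) s.
Proof. by rewrite -expect_map /expect (perm_big _ (perm_eq_seq_mset _)). Qed.

Lemma expect_mdirac (A : choiceType) (g : A -> R) a :
  expect g (mdirac R a) = g a.
Proof. by rewrite /mdirac /expect enum_msetn /= big_seq1 mul1r. Qed.

Lemma expect_union (A : choiceType) (g : A -> R) k (p : 'I_k -> R)
    (mu : 'I_k -> multidist R A) :
  expect g (\big[@msetD _/mset0]_(j < k) mdist_scale (p j) (mu j))%mset =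
  \sum_(j < k) p j * expect g (mu j).
Proof.
apply: (big_ind2 (fun (B : multidist R A) b => expect g B = b))
  => [|B b C c <- <-|j _].
- by rewrite /expect enum_mset0 big_nil.
- by rewrite /expect (perm_big _ (enum_msetD_perm _ _)) /= big_cat.
- rewrite /mdist_scale /mset_map /expect (perm_big _ (perm_eq_seq_mset _)) /=.
  by rewrite big_map mulr_sumr; apply: eq_bigr => x _ /=; rewrite mulrA.
Qed.

Lemma seq_mset_cat (K : choiceType) (s1 s2 : seq K) :
  seq_mset (s1 ++ s2) = (seq_mset s1 `+` seq_mset s2)%mset.
Proof. by apply/msetP => x; rewrite msetE2 !mset_seqE count_cat. Qed.

Lemma mset_map_seq_mset (K L : choiceType) (f : K -> L) (s : seq K) :
  mset_map f (seq_mset s) = seq_mset [seq f x | x <- s].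
Proof. by apply/eq_seq_msetP/perm_map/perm_eq_seq_mset. Qed.

Lemma perm_push (Q : eqType) (A : choiceType) (f : Q -> A)
    (s s' : seq (R * Q)) :
  perm_eq s s' -> push f s = push f s'.
Proof. by move=> ss'; apply/eq_seq_msetP/perm_map. Qed.

Lemma push_map (Q Q' : Type) (A : choiceType) (f : Q' -> A) (h : Q -> Q') s :
  push f [seq (x.1, h x.2) | x <- s] = push (f \o h) s.
Proof. by rewrite /push -map_comp. Qed.

Lemma push_id (A : choiceType) (mu : multidist R A) : push id mu = mu.
Proof.
rewrite /push; under eq_map do rewrite -surjective_pairing.
by rewrite map_id seq_mset_id.
Qed.

Lemma push_mset_map (A B C : choiceType) (f : B -> C) (h : A -> B)
    (mu : multidist R A) :
  push f (mset_map (fun x : R * A => (x.1, h x.2)) mu) =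
  mset_map (fun x : R * A => (x.1, f (h x.2))) mu.
Proof.
exact: etrans (mset_map_seq_mset _ _) (congr1 seq_mset (esym (map_comp _ _ _))).
Qed.

Lemma push_flatten (Q : Type) (A : choiceType) (f : Q -> A) I (r : seq I)
    (F : I -> seq (R * Q)) :
  push f (flatten [seq F i | i <- r]) =
  (\big[@msetD _/mset0]_(i <- r) push f (F i))%mset.
Proof.
elim: r => [|i r IH].
  by rewrite big_nil; apply/msetP => x; rewrite mset_seqE mset0E.
by rewrite big_cons -IH /= /push map_cat seq_mset_cat.
Qed.

Lemma push_scale (Q : Type) (A : choiceType) (f : Q -> A) p (s : seq (R * Q)) :
  push f [seq (p * y.1, y.2) | y <- s] = mdist_scale p (push f s).
Proof. by rewrite /push /mdist_scale mset_map_seq_mset -!map_comp. Qed.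

Lemma push1 (Q : Type) (A : choiceType) (f : Q -> A) q :
  push f [:: (1, q)] = mdirac R (f q).
Proof.
apply/msetP => x; rewrite mset_seqE /= addn0 /mdirac.
by rewrite msetnE eq_sym; case: eqP.
Qed.

Lemma push_weight (Q : eqType) (A : choiceType) (f : Q -> A) (s : seq (R * Q)) :
  is_fdist (push f s) -> forall x, x \in s -> 0 < x.1 <= 1.
Proof.
move=> [+ _] x xs => /(_ (x.1, f x.2)); apply.
rewrite (perm_mem (perm_eq_seq_mset _)).
by apply/mapP; exists x.
Qed.

Lemma sum_push (Q : Type) (A : choiceType) (f : Q -> A) (s : seq (R * Q)) :
  \sum_(x <- push f s) x.1 = \sum_(x <- s) x.1.
Proof. by rewrite (perm_big _ (perm_eq_seq_mset _)) big_map. Qed.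

Lemma is_fdist_mdirac (A : choiceType) (a : A) : is_fdist (mdirac R a).
Proof.
split; first by move=> x; rewrite in_msetn => /eqP -> /=; rewrite ltr01 lexx.
by rewrite enum_msetn big_seq1.
Qed.

End Expectation.

Variant escape_state (A : Type) := OnPath of nat | Escaped of nat & A.
Arguments OnPath {A} _.

HB.instance Definition _ (A : Type) := gen_eqMixin (escape_state A).

Section Derivations.
Variables (R : realType) (A : choiceType) (red : A -> multidist R A -> Prop).

Lemma SAST_PAST : SAST red -> PAST red.
Proof.
move=> sast a mu amu.
by apply: le_lt_trans (sast a); apply: ereal_sup_ubound; exists mu.
Qed.

Hypothesis red_fdist : forall a mu, red a mu -> is_fdist mu.

Definition live (a : A) : R := (~~ `[< normal_form red a >])%:R.

Lemma live_ge0 a : 0 <= live a. Proof. exact: ler0n. Qed.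

Lemma live_red a mu : red a mu -> live a = 1.
Proof.
by move=> amu; rewrite /live; case: asboolP => // nf; case: nf; exists mu.
Qed.

Lemma live_nf a : normal_form red a -> live a = 0.
Proof. by move=> nf; rewrite /live; case: asboolP. Qed.

Lemma sub_nf_mass mu : is_fdist mu -> 1 - nf_mass red mu = expect live mu.
Proof.
move=> [_ <-]; rewrite /nf_mass.
rewrite (bigID (fun x => `[< normal_form red x.2 >])) /=.
rewrite addrAC subrr add0r /expect big_mkcond /=; apply: eq_bigr => x _.
by rewrite /live; case: asboolP; rewrite ?mulr0 ?mulr1.
Qed.

Lemma expect_live_ge0 mu : is_fdist mu -> 0 <= expect live mu.
Proof.
move=> fd; apply: expect_ge0 => [x xmu|]; last exact: live_ge0.
exact: fdist_weight_ge0 xmu.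
Qed.

Lemma mlift_seq_fdist a mu :
  mlift_seq_from red a mu -> forall n, is_fdist (mu n).
Proof. by move=> [_ + n] => /(_ n) /(mlift_fdist red_fdist)[]. Qed.

Lemma edlE a mu : mlift_seq_from red a mu ->
  edl red mu = (\sum_(0 <= n <oo) (expect live (mu n))%:E)%E.
Proof.
move=> amu; apply: eq_eseriesr => n _; congr EFin.
exact: sub_nf_mass (mlift_seq_fdist amu n).
Qed.

Lemma edl_ge0 a mu : mlift_seq_from red a mu -> (0 <= edl red mu)%E.
Proof.
move=> amu; rewrite (edlE amu); apply: nneseries_ge0 => n _ _.
by rewrite lee_fin expect_live_ge0 //; exact: mlift_seq_fdist amu n.
Qed.

Lemma edl_le a mu (B : R) : mlift_seq_from red a mu ->
  (forall n, \sum_(0 <= i < n) expect live (mu i) <= B) ->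
  (edl red mu <= B%:E)%E.
Proof.
move=> amu muB; rewrite (edlE amu); apply: lime_le.
  apply: is_cvg_nneseries => n _ _; rewrite lee_fin expect_live_ge0 //.
  exact: mlift_seq_fdist amu n.
by apply: nearW => n /=; rewrite sumEFin lee_fin.
Qed.

Definition mstep (a : A) : set (multidist R A) :=
  [set mu | red a mu \/ normal_form red a /\ mu = mdirac R a].

Lemma mstep_mlift a mu : mstep a mu -> mlift red (mdirac R a) mu.
Proof. by move=> [/mlift_red//|[nf ->]]; exact: mlift_nf. Qed.

Lemma mstep_fdist a mu : mstep a mu -> is_fdist mu.
Proof. by move=> /mstep_mlift /(mlift_fdist red_fdist)[]. Qed.

Lemma mstep_nf a mu : normal_form red a -> mstep a mu -> mu = mdirac R a.
Proof. by move=> nf [amu|[]//]; case: nf; exists mu. Qed.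

Lemma mstep_red a mu : ~ normal_form red a -> mstep a mu -> red a mu.
Proof. by move=> nnf [//|[]]. Qed.

Lemma mstep_nonempty a : mstep a !=set0.
Proof.
have [nf|/contrapT[mu amu]] := pselect (normal_form red a).
  by exists (mdirac R a); right.
by exists mu; left.
Qed.

(* A strategy with memory: the states [Q] refine the objects [pos q] of the
   reduction, and [move] passes deterministically to distributions on states. *)
Section Policy.
Variables (Q : eqType) (pos : Q -> A) (move : Q -> seq (R * Q)).
Hypothesis moveP : forall q, mstep (pos q) (push pos (move q)).

Definition advance (s : seq (R * Q)) : seq (R * Q) :=
  flatten [seq [seq (x.1 * y.1, y.2) | y <- move x.2] | x <- s].

Definition policy_seq (q : Q) (n : nat) : multidist R A :=
  push pos (iter n advance [:: (1, q)]).

Lemma move_weight_ge0 q x : x \in move q -> 0 <= x.1.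
Proof. by move=> /(push_weight (mstep_fdist (moveP q))) /andP[/ltW]. Qed.

Lemma mlift_advance s : is_fdist (push pos s) ->
  mlift red (push pos s) (push pos (advance s)).
Proof.
move=> sfd; have -> : push pos s =
    (\big[@msetD _/mset0]_(x <- s) mdist_scale x.1 (mdirac R (pos x.2)))%mset.
  rewrite -[in LHS](flatten_seq1 s) push_flatten; apply: eq_bigr => x _.
  by rewrite -push1 -push_scale /= mulr1 -surjective_pairing.
rewrite /advance push_flatten.
under [X in mlift _ _ X]eq_bigr do rewrite push_scale.
rewrite !(big_tnth _ _ s); apply: mlift_union => [j||j].
- by apply: (push_weight sfd); exact: mem_tnth.
- rewrite -(big_tnth _ _ s predT (fun x => x.1)) /=.
  by rewrite -(sum_push pos s) sfd.2.
- exact/mstep_mlift/moveP.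
Qed.

Lemma policy_seqP q : mlift_seq_from red (pos q) (policy_seq q).
Proof.
split=> [|n]; first exact: push1.
apply: mlift_advance; elim: n => [|n IH] /=.
  by rewrite push1; exact: is_fdist_mdirac.
by case: (mlift_fdist red_fdist (mlift_advance IH)).
Qed.

Definition next_expect (g : Q -> R) (q : Q) : R := expect g (move q).

Lemma expect_advance g s : expect g (advance s) = expect (next_expect g) s.
Proof.
rewrite /expect /advance big_flatten /= big_map; apply: eq_bigr => x _.
by rewrite big_map mulr_sumr; apply: eq_bigr => y _ /=; rewrite mulrA.
Qed.

Lemma expect_policy_seq g n q :
  expect g (policy_seq q n) = iter n next_expect (g \o pos) q.
Proof.
rewrite expect_push -[RHS]expect1; elim: n (g \o pos) => [//|n IH] f.
by rewrite iterS expect_advance IH -iterSr.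
Qed.

Lemma iter_next_ge0 g n q : (forall q, 0 <= g q) -> 0 <= iter n next_expect g q.
Proof.
move=> g0; elim: n q => //= n IH q.
by apply: expect_ge0 => //; exact: move_weight_ge0.
Qed.

Lemma edl_policy_rec q : edl red (policy_seq q) =
  ((live (pos q))%:E + \sum_(x <- move q) x.1%:E * edl red (policy_seq x.2))%E.
Proof.
have alive0 n r : (0 <= (iter n next_expect (live \o pos) r)%:E)%E.
  by rewrite lee_fin iter_next_ge0 // => ?; exact: live_ge0.
have edl_iter r : edl red (policy_seq r) =
    (\sum_(0 <= n <oo) (iter n next_expect (live \o pos) r)%:E)%E.
  rewrite (edlE (policy_seqP r)).
  by apply: eq_eseriesr => n _; rewrite expect_policy_seq.
rewrite edl_iter nneseries_recl //; congr (_ + _)%E.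
rewrite -(nneseries_addn 1) => [|n]; last exact: alive0.
transitivity (\sum_(0 <= n <oo) \sum_(x <- move q | x \in move q)
    x.1%:E * (iter n next_expect (live \o pos) x.2)%:E)%E.
  apply: eq_eseriesr => n _; rewrite addn1 /= /next_expect /expect.
  by rewrite -sumEFin big_seq; under eq_bigr do rewrite EFinM.
rewrite nneseries_sum => [|x n xq]; last first.
  by rewrite mule_ge0 // lee_fin; exact: move_weight_ge0 xq.
rewrite -big_seq; apply: eq_bigr => x _.
by rewrite nneseriesZl // edl_iter.
Qed.

Definition policy_steps (q : Q) : R := fine (edl red (policy_seq q)).

Lemma policy_steps_ge0 q : 0 <= policy_steps q.
Proof. exact: fine_ge0 (edl_ge0 (policy_seqP q)). Qed.

Lemma policy_stepsE q : PAST red ->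
  policy_steps q = live (pos q) + expect policy_steps (move q).
Proof.
move=> past; have edl_fin r : edl red (policy_seq r) = (policy_steps r)%:E.
  rewrite fineK // ge0_fin_numE ?(edl_ge0 (policy_seqP r)) //.
  exact: past (policy_seqP r).
apply: EFin_inj; rewrite -edl_fin edl_policy_rec EFinD -sumEFin.
by congr (_ + _)%E; apply: eq_bigr => x _; rewrite edl_fin EFinM.
Qed.

End Policy.

Definition context (F : A -> A) :=
  forall a mu, red a mu -> red (F a) (push F mu).

Definition bicontext (C : A -> A -> A) :=
  (forall b, context (C^~ b)) /\ (forall a, context (C a)).

Definition successor (a b : A) := exists mu p, red a mu /\ (p, b) \in mu.

Section FiniteBranching.
Hypothesis red_finite : forall a, finite_set (red a).

Lemma finite_mstep a : finite_set (mstep a).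
Proof.
apply: (@sub_finite_set _ _ (red a `|` [set mdirac R a])).
  by move=> mu [|[_ ->]]; [left|right].
by rewrite finite_setU; split; [exact: red_finite|exact: finite_set1].
Qed.

Definition greedy (g : A -> R) (a : A) : multidist R A :=
  xget mset0 [set mu | mstep a mu /\
    forall nu, mstep a nu -> expect g nu <= expect g mu].

Lemma greedyP g a : mstep a (greedy g a) /\
  forall nu, mstep a nu -> expect g nu <= expect g (greedy g a).
Proof.
rewrite /greedy; case: xgetP => [mu _ //|none].
have [mu amu muP] := finite_set_argmax (fun nu : multidist R A => expect g nu)
  (finite_mstep a) (mstep_nonempty a).
by case: (none mu).
Qed.

Lemma greedy_weight_ge0 g a x : x \in greedy g a -> 0 <= x.1.
Proof. exact: fdist_weight_ge0 (mstep_fdist (greedyP g a).1) _. Qed.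

Fixpoint opt_steps (k : nat) (a : A) : R :=
  if k is k'.+1 then live a + expect (opt_steps k') (greedy (opt_steps k') a)
  else 0.

Definition opt_bounded (a : A) := has_ubound (range (opt_steps^~ a)).

Lemma opt_steps_ge0 k a : 0 <= opt_steps k a.
Proof.
elim: k a => //= k IH a; rewrite addr_ge0 ?live_ge0 //.
by apply: expect_ge0 => // x; exact: greedy_weight_ge0.
Qed.

Lemma opt_steps_nf k a : normal_form red a -> opt_steps k a = 0.
Proof.
move=> nf; elim: k => //= k IH.
by rewrite (mstep_nf nf (greedyP _ a).1) expect_mdirac IH live_nf // addr0.
Qed.

Lemma opt_steps_mstep k a mu :
  mstep a mu -> live a + expect (opt_steps k) mu <= opt_steps k.+1 a.
Proof. by move=> amu /=; rewrite lerD2l; apply: (greedyP _ a).2. Qed.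

Lemma opt_steps_mlift k mu nu : mlift red mu nu ->
  expect live mu + expect (opt_steps k) nu <= expect (opt_steps k.+1) mu.
Proof.
elim=> [a nf|a mu' amu|m p mu' nu' p01 _ _ IH].
- rewrite (expect_mdirac live) [leRHS]expect_mdirac.
  by apply: opt_steps_mstep; right.
- rewrite (expect_mdirac live) [leRHS]expect_mdirac.
  by apply: opt_steps_mstep; left.
rewrite !expect_union -big_split /=; apply: ler_sum => j _.
by rewrite -mulrDr ler_wpM2l //; have /andP[/ltW] := p01 j.
Qed.

Lemma sum_live_le_opt_steps n mu : (forall i, mlift red (mu i) (mu i.+1)) ->
  \sum_(0 <= i < n) expect live (mu i) <= expect (opt_steps n) (mu 0%N).
Proof.
elim: n mu => [|n IH] mu muP.
  by rewrite big_geq // /expect big1 // => x _; rewrite mulr0.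
rewrite big_nat_recl //; apply: le_trans (opt_steps_mlift n (muP 0%N)).
by rewrite lerD2l; apply: (IH (fun i => mu i.+1)).
Qed.

Lemma opt_bounded_SAST : (forall a, opt_bounded a) -> SAST red.
Proof.
move=> bounded a; have [B aB] := bounded a.
apply: (@le_lt_trans _ _ B%:E); last exact: ltry.
apply: ge_ereal_sup => _ [mu amu <-]; apply: (edl_le amu) => n.
apply: le_trans (sum_live_le_opt_steps n amu.2) _.
by rewrite amu.1 expect_mdirac; apply: aB; exists n.
Qed.

Lemma opt_bounded_successors a :
  (forall b, successor a b -> opt_bounded b) -> opt_bounded a.
Proof.
move=> bounded; have [nf|nnf] := pselect (normal_form red a).
  by exists 0 => _ [k _ <-]; rewrite opt_steps_nf.
pose B b := sup (range (opt_steps^~ b)).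
suff opt_le k : opt_steps k.+1 a <= live a + expect B (greedy B a).
  exists (live a + expect B (greedy B a)) => _ [[|k] _ <-]; last exact: opt_le.
  exact: le_trans (opt_steps_ge0 1 a) (opt_le 0%N).
have [step_k _] := greedyP (opt_steps k) a.
rewrite lerD2l; apply: le_trans ((greedyP B a).2 _ step_k).
apply: le_expect => [x|x xk]; first exact: greedy_weight_ge0.
apply: ub_le_sup; last by exists k.
apply: bounded; exists (greedy (opt_steps k) a), x.1.
by rewrite -surjective_pairing; split=> //; exact: mstep_red.
Qed.

Lemma unbounded_path a : ~ opt_bounded a ->
  exists2 t : nat -> A, t 0%N = a & forall n, successor (t n) (t n.+1).
Proof.
move=> unb_a; pose unbounded := {b | ~ opt_bounded b}.
have next_unbounded (b : unbounded) :
    {c : unbounded | successor (sval b) (sval c)}.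
  apply: cid; apply: contrapT => no_next; apply: (svalP b).
  apply: opt_bounded_successors => c bc; apply: contrapT => unb_c.
  by apply: no_next; exists (exist _ c unb_c).
have [t [t0 tS]] := dependent_choice next_unbounded (exist _ a unb_a).
by exists (sval \o t) => //=; rewrite t0.
Qed.

Lemma opt_steps_context F k a : context F -> opt_steps k a <= opt_steps k (F a).
Proof.
move=> cF; elim: k a => // k IH a.
have [nf|nnf] := pselect (normal_form red a).
  by rewrite opt_steps_nf // opt_steps_ge0.
have amu := mstep_red nnf (greedyP (opt_steps k) a).1.
have Famu := cF _ _ amu.
apply: le_trans (opt_steps_mstep k (or_introl Famu)).
rewrite /= (live_red amu) (live_red Famu) lerD2l expect_push.
by apply: le_expect => x; [exact: greedy_weight_ge0|move=> _; exact: IH].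
Qed.

(* In state [OnPath n] the policy reduces the first argument of [C (t n) a] by
   [mu n]; an outcome [C b a] off the path is left to greedy play for [K n]
   rounds, which gains at least as much as from the untouched argument [a]. *)
Section Escape.
Variables (C : A -> A -> A) (a : A).
Hypothesis C_bicontext : bicontext C.
Variables (t : nat -> A) (mu : nat -> multidist R A) (p : nat -> R).
Hypothesis t_red : forall n, red (t n) (mu n).
Hypothesis t_next : forall n, (p n, t n.+1) \in mu n.
Variable K : nat -> nat.

Definition escape_pos (q : escape_state A) : A :=
  match q with OnPath n => C (t n) a | Escaped _ b => b end.

Definition escape_move (q : escape_state A) : seq (R * escape_state A) :=
  match q with
  | OnPath n => (p n, OnPath n.+1) ::
      [seq (x.1, Escaped (K n) (C x.2 a)) | x <- rem (p n, t n.+1) (mu n)]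
  | Escaped k b =>
      [seq (x.1, Escaped k.-1 x.2) | x <- greedy (opt_steps k.-1) b]
  end.

Let steps := policy_steps escape_pos escape_move.

Lemma escape_moveP q : mstep (escape_pos q) (push escape_pos (escape_move q)).
Proof.
case: q => [n|k b] /=; last first.
  by rewrite push_map [push _ _]push_id; exact: (greedyP _ b).1.
left; suff -> : push escape_pos (escape_move (OnPath n)) = push (C^~ a) (mu n).
  exact: (C_bicontext.1 a).
rewrite (perm_push _ (perm_to_rem (t_next n))).
by rewrite /push /= -map_comp.
Qed.

Lemma opt_steps_le_escaped k b : PAST red ->
  opt_steps k b <= steps (Escaped k b).
Proof.
move=> past; elim: k b => [|k IH] b.
  exact: policy_steps_ge0 escape_moveP _.
rewrite /steps (policy_stepsE escape_moveP) //= lerD2l expect_map.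
by apply: le_expect => x; [exact: greedy_weight_ge0|move=> _; exact: IH].
Qed.

Lemma escape_steps_rec n : PAST red ->
  1 + (p n * steps (OnPath n.+1) + (1 - p n) * opt_steps (K n) a) <=
  steps (OnPath n).
Proof.
move=> past; have mu_fdist := red_fdist (t_red n).
rewrite [leRHS](policy_stepsE escape_moveP) //=.
rewrite (live_red (C_bicontext.1 a _ _ (t_red n))) lerD2l.
rewrite /expect big_cons lerD2l big_map.
have -> : 1 - p n = \sum_(x <- rem (p n, t n.+1) (mu n)) x.1.
  rewrite -mu_fdist.2 (perm_big _ (perm_to_rem (t_next n))) big_cons /=.
  by rewrite addrAC subrr add0r.
rewrite mulr_suml !big_seq; apply: ler_sum => x /mem_rem xmu.
rewrite ler_wpM2l ?(fdist_weight_ge0 mu_fdist xmu) //=.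
apply: le_trans (opt_steps_le_escaped _ _ past).
exact: opt_steps_context (C_bicontext.2 _).
Qed.

End Escape.

Theorem PAST_SAST (C : A -> A -> A) : bicontext C -> PAST red -> SAST red.
Proof.
move=> C_bicontext past; apply: opt_bounded_SAST => a.
apply: contrapT => unb_a.
have [t _ /choice[mu]] := unbounded_path unb_a.
move=> /choice[p /all_and2[t_red t_next]].
have p01 n : 0 < p n <= 1 by exact: (red_fdist (t_red n)).1 (t_next n).
have /choice[K K_large] n :
    exists k, (survival p n * survival p n.+1)^-1 <= opt_steps k a.
  have /has_ubPn/(_ (survival p n * survival p n.+1)^-1)[_ [k _ <-]] := unb_a.
  by move=> /ltW; exists k.
apply: (escape_recursion_no_solution p01 K_large).
exists (fun n => policy_steps (escape_pos C a t) (escape_move C a t mu p K)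
  (OnPath n)) => n.
- by apply: policy_steps_ge0; exact: escape_moveP.
- exact: escape_steps_rec.
Qed.

End FiniteBranching.
End Derivations.

Section TermRewriting.
Variables (R : realType) (S : signature) (V : countType).
Implicit Types (t u v : term S V) (s : V -> term S V).

Lemma subterm_at_nil t : subterm_at t [::] = Some t.
Proof. by case: t. Qed.

Lemma subst_eq_vars s s' t : subst s t = subst s' t ->
  forall x, vars t x -> s x = s' x.
Proof.
elim: t => [y sE x /= -> //|f a IH sE x [i _ ix]]; apply: IH ix.
have := congr1 (fun u => subterm_at u [:: val i]) sE => /=.
by rewrite valK !subterm_at_nil => -[].
Qed.

Lemma eq_subst s s' t : (forall x, vars t x -> s x = s' x) ->
  subst s t = subst s' t.
Proof.
elim: t => [y|f a IH] ss' /=; first exact: ss'.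
by congr App; apply/funext => i; apply: IH => x ix; apply: ss'; exists i.
Qed.

Lemma finite_positions t : finite_set [set pi | subterm_at t pi <> None].
Proof.
elim: t => [x|f a IH].
  by apply: (sub_finite_set _ (finite_set1 [::])) => -[|i pi].
apply: (@sub_finite_set _ _ ([set [::]] `|` \bigcup_(i in [set: 'I_(arity f)])
    cons (val i) @` [set pi | subterm_at (a i) pi <> None])).
  move=> [|i pi] /=; first by left.
  case: insubP => [j _ <-|//] apij; right; exists j => //.
  by exists pi.
rewrite finite_setU; split; first exact: finite_set1.
by apply: bigcup_finite => // i _; exact/finite_image/IH.
Qed.

Definition reducts_at (r : rule R S V) t (pi : seq nat) :
    set (multidist R (term S V)) :=
  [set nu | exists2 s, subterm_at t pi = Some (subst s r.1) &
    nu = mset_map (fun x : R * term S V =>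
           (x.1, replace_at t pi (subst s x.2))) r.2].

Lemma reducts_at_subset1 (r : rule R S V) t pi :
  is_rule r -> is_subset1 (reducts_at r t pi).
Proof.
move=> [_ _ r_vars] _ _ [s tpi ->] [s' + ->].
rewrite tpi => -[/subst_eq_vars ss']; congr seq_mset.
apply/eq_in_map => x xr; congr (_, replace_at _ _ _).
by apply: eq_subst => y xy; exact: ss' (r_vars x xr y xy).
Qed.

Lemma finite_rewrite_full (P : ptrs R S V) t : finite_set (rules P) ->
  finite_set (rewrite_full P t).
Proof.
move=> finP; apply: (@sub_finite_set _ _ (\bigcup_(r in rules P)
    \bigcup_(pi in [set pi | subterm_at t pi <> None]) reducts_at r t pi)).
  move=> nu [r [pi [s [Pr tpi ->]]]]; exists r => //.
  by exists pi; rewrite /= ?tpi //; exists s.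
apply: bigcup_finite => // r Pr; apply: bigcup_finite => [|pi _].
  exact: finite_positions.
exact/finite_subset1/reducts_at_subset1/(rules_wf Pr).
Qed.

Lemma context_App (P : ptrs R S V) f (a : 'I_(arity f) -> term S V) i :
  context (rewrite_full P) (fun u => App f [eta a with i |-> u]).
Proof.
move=> u _ [r [pi [s [Pr upi ->]]]]; exists r, (val i :: pi), s; split=> //.
  by rewrite /= valK /= eqxx.
rewrite (push_mset_map _ (fun v => replace_at u pi (subst s v))).
congr seq_mset; apply/eq_map => x /=; congr (_, App _ _); apply/funext => j /=.
by rewrite (inj_eq val_inj); case: eqP.
Qed.

Lemma bicontext_App (P : ptrs R S V) f (i j : 'I_(arity f)) t : i != j ->
  bicontext (rewrite_full P)
    (fun u v => App f [eta fun=> t with i |-> u, j |-> v]).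
Proof.
move=> ij; split=> [v|u]; first exact: context_App.
rewrite (_ : (fun v => _) =
    fun v => App f [eta [eta fun=> t with i |-> u] with j |-> v]).
  exact: context_App.
apply/funext => v; congr App; apply/funext => k /=.
by case: (eqVneq k i) => [->|//]; rewrite (negPf ij).
Qed.

End TermRewriting.

Theorem theorem3p21 (R : realType) (S : signature) (V : countType)
    (P : ptrs R S V) (finP : finite_set (rules P))
    (binS : exists f : symbol S, (2 <= arity f)%N) :
  PAST (rewrite_full P) <-> SAST (rewrite_full P).
Proof.
split; last exact: SAST_PAST.
have [f f_ge2] := binS => past t.
pose i : 'I_(arity f) := Ordinal (ltnW f_ge2); pose j := Ordinal f_ge2.
apply: (PAST_SAST _ _ (@bicontext_App R S V P f i j t isT) past).
- exact: (@rewrite_full_fdist _ _ _ P).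
- by move=> u; exact: finite_rewrite_full.
Qed.
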